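(* Let $s, n$ be positive integers such that $n$ is the $s$-th power of some natural number, and let $\chi$ be a primitive Dirichlet character mod $n$. Then $$\sum_{\substack{k=1\\(k,n)_s = 1}}^{n} (k-1,n)_s\, \chi(k) = \Phi_s(n).$$
   Context: $\mathbb{N}$ denotes the positive integers. For an integer $a \ge 0$ and positive integers $b, s$, the generalized gcd $(a,b)_s$ is the largest $l^s$ with $l \in \mathbb{N}$ dividing both $a$ and $b$ (every integer divides $0$, so $(0,b)_s$ is the largest $s$-th power dividing $b$). Klee's function is $\Phi_s(n) = \#\{m \in \mathbb{N} : 1 \le m \le n,\ (m,n)_s = 1\}$. As usual, a Dirichlet character $\chi$ mod $n$ satisfies $\chi(k)=0$ when $k$ and $n$ are not coprime in the ordinary sense. *)

(* Defs.v *)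
From HB Require Import structures.
From mathcomp Require Import all_boot all_order all_algebra.
From mathcomp Require Import reals complex.

Set Implicit Arguments.
Unset Strict Implicit.
Unset Printing Implicit Defensive.

Import Order.TTheory GRing.Theory Num.Theory.
Local Open Scope ring_scope.
Local Open Scope complex_scope.

(* The generalized gcd (a, b)_s.  The range of l is exhaustive when b and s   *)
(* are positive, since then l ^ s %| b forces l <= l ^ s <= b.                *)
Definition gen_gcdn (s a b : nat) : nat :=
  (\max_(1 <= l < b.+1 | (l ^ s %| a) && (l ^ s %| b)) l ^ s)%N.

Definition klee (s n : nat) : nat :=
  #|[set m : 'I_n.+1 | (0 < m)%N && (gen_gcdn s m n == 1%N)]|.

(* The homomorphism (Z/nZ)^* -> C^*, extended by zero, is presented as a      *)
(* function on all integers.                                                  *)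
Record dirichlet_char (R : realType) (n : nat) := DirichletChar {
  dchar_fun :> int -> R[i];
  dchar_periodic : forall k : int, dchar_fun (k + n%:Z) = dchar_fun k;
  dchar_mul : forall j k : int, dchar_fun (j * k) = dchar_fun j * dchar_fun k;
  dchar_neq0 : forall k : int, (dchar_fun k != 0) = coprimez k n%:Z }.

Definition induced_by (R : realType) (n d : nat)
    (chi : dirichlet_char R n) (psi : dirichlet_char R d) : Prop :=
  forall k : int, coprimez k n%:Z -> chi k = psi k.

(* The unique character mod 1 is primitive, as 1 has no proper divisor.       *)
Definition primitive_char (R : realType) (n : nat)
    (chi : dirichlet_char R n) : Prop :=
  forall (d : nat) (psi : dirichlet_char R d),
    (d %| n)%N -> (d < n)%N -> ~ induced_by chi psi.

(* Main.v *)
Require Import Defs.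
From mathcomp Require Import all_boot all_order all_algebra.
From mathcomp Require Import reals complex.
From mathcomp Require Import ring.

Import Order.TTheory GRing.Theory Num.Theory.
Local Open Scope ring_scope.
Local Open Scope complex_scope.

(** If chi k <> 0 then k is coprime to n, so (k, n)_s = 1 and the terms
excluded by the restriction on k are 0: the sum may run over all k mod n.

Write n = m ^ s and g(a) = (a, n)_s.  Every g(a) is l ^ s for a divisor l of m
that is the top element, for divisibility, of the set of d dividing m with
d ^ s dividing a ([gen_gcdn_spec]).  In these terms n / g(a) divides x exactly
when m divides the product of the l attached to a and the l attached to x,
which is symmetric in a and x ([gen_gcdn_codvd_sym]).  As n / g(a) has exactly
g(a) multiples in 1, ..., n, the weight g(k - 1) counts the x in 1, ..., n such
that n / g(x) divides k - 1 ([gen_gcdn_count]).  This replaces a Moebius or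
Jordan-totient expansion of g by a double counting.

Exchanging the two summations leaves, for each x, the sum of chi over the
progression k = 1 mod D with D = n / g(x).  If D < n, primitivity makes chi
nontrivial on the units of that progression, and the sum vanishes; if D = n,
only k = 1 remains and the sum is 1 ([sum_primitive_char_progression]).  The
total is the number of x with g(x) = 1, that is, Klee's function at n.

The definition of primitivity speaks of induced characters, so the vanishing
needs a descent argument: a character mod n trivial on the units congruent to
1 mod D comes from a character mod D ([dchar_descent]).  That rests on the
surjectivity of the map from units mod n to units mod D
([coprimez_liftP]). *)

(** * The generalized gcd with an s-th power *)

(** Dividing d and e by their gcd makes them coprime, and then so are their
s-th powers; this is what makes the common s-power divisors closed under
lcm. *)
Lemma lcmn_exp_dvdn (s a d e : nat) :
  (0 < d)%N -> (d ^ s %| a -> e ^ s %| a -> lcmn d e ^ s %| a)%N.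
Proof.
move=> d0 da ea; have g0 : (0 < gcdn d e)%N by rewrite gcdn_gt0 d0.
set g := gcdn d e in g0 *.
have dE : d = (d %/ g * g)%N by rewrite divnK ?dvdn_gcdl.
have eE : e = (e %/ g * g)%N by rewrite divnK ?dvdn_gcdr.
have co : coprime (d %/ g) (e %/ g).
  by rewrite /coprime -(eqn_pmul2r g0) muln_gcdl -dE -eE mul1n.
have lE : lcmn d e = (d %/ g * (e %/ g) * g)%N.
  by apply/eqP; rewrite -(eqn_pmul2r g0) muln_lcm_gcd {1}dE {1}eE; apply/eqP; ring.
have /dvdnP [b ab] : (g ^ s %| a)%N.
  by apply: dvdn_trans da; rewrite dvdn_exp2r ?dvdn_gcdl.
have gs0 : (0 < g ^ s)%N by rewrite expn_gt0 g0.
move: da ea; rewrite lE {1}dE {1}eE ab !expnMn !dvdn_pmul2r // => da ea.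
by rewrite Gauss_dvd ?da ?coprimeXl ?coprimeXr.
Qed.

(** The maximum that defines (a, m ^ s)_s is taken for size; closure under lcm
upgrades it to a maximum for divisibility. *)
Lemma gen_gcdn_spec (s m a : nat) : (0 < s)%N -> (0 < m)%N ->
  exists l : nat, [/\ (l %| m)%N, gen_gcdn s a (m ^ s) = (l ^ s)%N &
    forall d : nat, (d %| m)%N -> (d ^ s %| a)%N = (d %| l)%N].
Proof.
move=> s0 m0; pose l := (\big[lcmn/1%N]_(d <- divisors m | d ^ s %| a) d)%N.
have [l0 lm la] : [/\ (0 < l)%N, (l %| m)%N & (l ^ s %| a)%N].
  rewrite /l big_seq_cond; apply: (big_ind (fun l => [/\ (0 < l)%N, (l %| m)%N & (l ^ s %| a)%N])).
  - by rewrite exp1n !dvd1n.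
  - move=> x y [x0 xm xa] [y0 ym ya].
    by rewrite lcmn_gt0 x0 y0 dvdn_lcm xm ym lcmn_exp_dvdn.
  - move=> d /andP[]; rewrite -dvdn_divisors // => dm da.
    by rewrite (dvdn_gt0 m0 dm).
have lmax d : (d %| m)%N -> (d ^ s %| a)%N -> (d %| l)%N.
  move=> dm da; rewrite /l -big_filter (bigD1_seq d) ?filter_uniq ?divisors_uniq //=.
    exact: dvdn_lcml.
  by rewrite mem_filter da -dvdn_divisors.
exists l; split=> // [|d dm]; last first.
  by apply/idP/idP => [|dl]; [exact: lmax | apply: dvdn_trans la; exact: dvdn_exp2r].
apply/eqP; rewrite eqn_leq; apply/andP; split.
  apply/bigmax_leqP_seq => d _ /andP[da]; rewrite dvdn_pexp2r // => dm.
  by rewrite leq_exp2r // dvdn_leq // lmax.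
apply: (leq_bigmax_seq (F := fun d => (d ^ s)%N)); last by rewrite la dvdn_exp2r.
rewrite mem_index_iota l0 ltnS; apply: leq_trans (dvdn_leq m0 lm) _.
by rewrite -{1}(expn1 m) leq_pexp2l.
Qed.

Lemma gen_gcdn_dvdn (s m a : nat) : (0 < s)%N -> (0 < m)%N ->
  (gen_gcdn s a (m ^ s) %| m ^ s)%N.
Proof.
by move=> s0 m0; have [l [lm -> _]] := gen_gcdn_spec s m a s0 m0; exact: dvdn_exp2r.
Qed.

Lemma gen_gcdn_coprime (s k n : nat) : (0 < s)%N -> (0 < n)%N -> coprime k n ->
  gen_gcdn s k n = 1%N.
Proof.
move=> s0 n0 co; apply/eqP; rewrite eqn_leq; apply/andP; split.
  apply/bigmax_leqP_seq => d _ /andP[dk dn].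
  by rewrite dvdn_leq // -(eqP co) dvdn_gcd dk.
apply: (bigmaxn_sup_seq 1%N); rewrite ?exp1n ?dvd1n //.
by rewrite mem_index_iota.
Qed.

(** If g(a) = k ^ s and g(x) = l ^ s, both sides say that m divides k * l. *)
Lemma gen_gcdn_codvd_sym (s m a x : nat) : (0 < s)%N -> (0 < m)%N ->
  (m ^ s %/ gen_gcdn s a (m ^ s) %| x)%N = (m ^ s %/ gen_gcdn s x (m ^ s) %| a)%N.
Proof.
move=> s0 m0.
have [k [km -> ka]] := gen_gcdn_spec s m a s0 m0.
have [l [lm -> lx]] := gen_gcdn_spec s m x s0 m0.
have divX d : (d %| m)%N -> (m ^ s %/ d ^ s)%N = ((m %/ d) ^ s)%N.
  move=> dm; rewrite -{1}(divnK dm) expnMn mulnK // expn_gt0.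
  by rewrite (dvdn_gt0 m0 dm).
have divd d : (d %| m)%N -> (m %/ d %| m)%N.
  by move=> dm; rewrite -{2}(divnK dm) dvdn_mulr.
rewrite !divX // lx ?divd // ka ?divd //.
have k0 := dvdn_gt0 m0 km; have l0 := dvdn_gt0 m0 lm.
by rewrite -(dvdn_pmul2r k0) divnK // -[RHS](dvdn_pmul2r l0) divnK // mulnC.
Qed.

(** An integer g dividing N counts the multiples of N / g up to N; the symmetry
then moves the argument a out of the divisor, so that sums over a become sums
over progressions. *)
Lemma gen_gcdn_count (s m a : nat) : (0 < s)%N -> (0 < m)%N ->
  gen_gcdn s a (m ^ s) =
  (\sum_(1 <= x < (m ^ s).+1) (m ^ s %/ gen_gcdn s x (m ^ s) %| a))%N.
Proof.
move=> s0 m0; have n0 : (0 < m ^ s)%N by rewrite expn_gt0 m0.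
have gm := gen_gcdn_dvdn s m a s0 m0.
transitivity (\sum_(1 <= x < (m ^ s).+1) (m ^ s %/ gen_gcdn s a (m ^ s) %| x))%N.
  by rewrite -divn_count_dvd divnA // mulKn.
by apply: eq_bigr => x _; rewrite gen_gcdn_codvd_sym.
Qed.

(** * Lifting units *)

(** Take for t the part of n that is prime to k: a prime dividing n divides
exactly one of k and t, and one dividing k does not divide D. *)
Lemma coprime_add_mul (n D k : nat) : (0 < n)%N -> (0 < k)%N ->
  coprime k D -> exists t : nat, coprime (k + D * t) n.
Proof.
move=> n0 k0 kD; exists (n`_(\pi(k)^'))%N; rewrite coprime_sym coprime_has_primes //; last first.
  by rewrite addn_gt0 k0.
apply/hasPn => p; rewrite mem_primes /= addn_gt0 k0 /= => /andP[pp pkt].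
apply/negP => pn.
have pt : (p %| n`_(\pi(k)^'))%N = ~~ (p %| k)%N.
  have := mem_primes p (n`_(\pi(k)^'))%N.
  rewrite primes_part mem_filter pn andbT pp part_gt0 /= => <-.
  by rewrite !inE mem_primes pp k0.
move: pkt; case pk: (p %| k)%N.
  rewrite dvdn_addr // Euclid_dvdM // pt pk orbF => pD.
  have : (p %| 1)%N by rewrite -(eqP kD) dvdn_gcd pk.
  by rewrite dvdn1 => /eqP p1; rewrite p1 in pp.
by rewrite dvdn_addl ?pk // dvdn_mull // pt pk.
Qed.

Lemma coprimez_congr (n D : nat) (j k : int) : (D %| n)%N ->
  coprimez j n%:Z -> (D%:Z %| j - k)%Z -> coprimez k D%:Z.
Proof.
move=> /dvdnP[e nD] /coprimezP[[b c] /= jn] /dvdzP[q jk].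
have nZ : n%:Z = e%:Z * D%:Z by rewrite -PoszM -nD.
apply/coprimezP; exists (b, b * q + c * e%:Z) => /=.
by rewrite -jn nZ -[j](subrK k) jk; ring.
Qed.

Lemma coprimez_liftP (n D : nat) (k : int) : (0 < n)%N -> (D %| n)%N ->
  reflect (exists2 j : 'I_n, coprimez j n%:Z & (D%:Z %| j%:Z - k)%Z)
    (coprimez k D%:Z).
Proof.
move=> n0 Dn; apply: (iffP idP) => [kD | [j jn jk]]; last exact: (coprimez_congr n D j k).
have D0 := dvdn_gt0 n0 Dn.
have [a ak] : exists a : nat, (k %% D%:Z)%Z = a%:Z.
  by exists `|(k %% D%:Z)%Z|%N; rewrite gez0_abs // modz_ge0 // -lt0n.
(* When D = 1 the residue a is 0; adding D gives a positive representative. *)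
have aD : coprime (a + D) D.
  by rewrite /coprime gcdnC gcdnDr gcdnC -/(coprime _ _) -(coprimezE a%:Z D%:Z) -ak /coprimez gcdz_modl.
have aD0 : (0 < a + D)%N by rewrite addn_gt0 D0 orbT.
have [t tn] := coprime_add_mul n D (a + D)%N n0 aD0 aD.
exists (Ordinal (ltn_pmod (a + D + D * t) n0)); first by rewrite coprimezE /= coprime_modl.
have nk : (n%:Z %| ((a + D + D * t) %% n)%N%:Z - (a + D + D * t)%N%:Z)%Z.
  by rewrite -eqz_mod_dvd -modz_nat modz_mod.
rewrite -[_ - k](subrKA (a + D + D * t)%N%:Z) rpredD ?(dvdz_trans _ nk) //.
rewrite (divz_eq k D%:Z) ak !PoszD PoszM.
rewrite [X in (_ %| X)%Z](_ : _ = D%:Z * (1 + t%:Z - (k %/ D%:Z)%Z)) ?dvdz_mulr //.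
by ring.
Qed.

(** * Dirichlet characters *)

Lemma dchar_eqmod (R : realType) (n : nat) (chi : dirichlet_char R n) (j k : int) :
  (n%:Z %| j - k)%Z -> chi j = chi k.
Proof.
have P (i : int) (t : nat) : chi (i + t%:Z * n%:Z) = chi i.
  elim: t => [|t IH]; first by rewrite mul0r addr0.
  by rewrite -IH -[RHS](dchar_periodic chi); congr (chi _); rewrite intS; ring.
move=> /dvdzP[[t|t] E].
  by rewrite -(P k t) -E addrC subrK.
rewrite -(P j t.+1); congr (chi _).
by rewrite -[j](subrK k) E NegzE; ring.
Qed.

Lemma dchar1 (R : realType) (n : nat) (chi : dirichlet_char R n) : chi 1 = 1.
Proof.
have c0 : chi 1 != 0 by rewrite dchar_neq0 coprimezE /= coprime1n.
by apply: (mulfI c0); rewrite -dchar_mul !mulr1.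
Qed.

(** Triviality on the units congruent to 1 mod D makes chi depend, on units mod
n, only on the class mod D; the descended character evaluates chi at any lift
of its argument to a unit mod n, and is 0 where there is no lift.  The units in
the hypothesis are written v + 1 so that the congruence becomes D %| v. *)
Lemma dchar_descent (R : realType) (n D : nat) (chi : dirichlet_char R n) :
  (0 < n)%N -> (D %| n)%N ->
  (forall v : nat, (D %| v)%N -> coprime v.+1 n -> chi v.+1%:Z = 1) ->
  exists psi : dirichlet_char R D, induced_by chi psi.
Proof.
move=> n0 Dn triv; have Dnz : (D%:Z %| n%:Z)%Z by [].
(* With c inverse to k mod n, the hypothesis applies to the residue of j * c. *)
have chiD (j k : int) : coprimez j n%:Z -> coprimez k n%:Z ->
    (D%:Z %| j - k)%Z -> chi j = chi k.
  move=> jn kn jk; have /coprimezP[[c b] /= cb] := kn.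
  have kc : chi k * chi c = 1.
    rewrite -dchar_mul -(dchar1 _ _ chi); apply: dchar_eqmod.
    by rewrite -cb; apply/dvdzP; exists (- b); ring.
  have c0 : chi c != 0.
    by apply/eqP => c0; move/eqP: kc; rewrite c0 mulr0 eq_sym oner_eq0.
  apply: (mulIf c0); rewrite kc -dchar_mul.
  have [v vE] : exists v : nat, ((j * c - 1) %% n%:Z)%Z = v%:Z.
    exists `|((j * c - 1) %% n%:Z)%Z|%N.
    by rewrite gez0_abs // modz_ge0 // -lt0n.
  have := divz_eq (j * c - 1) n%:Z; rewrite vE; move: (_ %/ _)%Z => q E.
  have chiv : chi (j * c) = chi v.+1%:Z.
    apply: dchar_eqmod; apply/dvdzP; exists q.
    by rewrite intS opprD addrA E addrK.
  rewrite chiv; apply: triv.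
    have -> : (D %| v)%N = (D%:Z %| v%:Z)%Z by [].
    have -> : v%:Z = (j - k) * c - (b + q) * n%:Z.
      move: E; rewrite -cb => E; rewrite -[v%:Z](addKr (q * n%:Z)) -E; ring.
    by apply: rpredB; [exact: dvdz_mulr | exact: dvdz_mull].
  rewrite -[coprime _ _]/(coprimez v.+1%:Z n%:Z) -(dchar_neq0 chi) -chiv.
  by rewrite dchar_mul mulf_neq0 ?c0 ?dchar_neq0.
pose f (k : int) : R[i] :=
  if [pick j : 'I_n | coprimez j n%:Z && (D%:Z %| j%:Z - k)%Z] is Some j
  then chi j else 0.
have fE (j k : int) : coprimez j n%:Z -> (D%:Z %| j - k)%Z -> f k = chi j.
  move=> jn jk.
  have kD : coprimez k D%:Z by exact: (coprimez_congr n D j k).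
  have [i ni ik] := coprimez_liftP n D k n0 Dn kD.
  rewrite /f; case: pickP => [i' /andP[i'n i'k] | /(_ i)]; last by rewrite ni ik.
  by apply: chiD => //; rewrite -[_ - j](subrKA k) rpredD // -opprB rpredN.
have f0 (k : int) : ~~ coprimez k D%:Z -> f k = 0.
  move=> kD; rewrite /f; case: pickP => // i /andP[ni ik].
  by case/negP: kD; apply/(coprimez_liftP n D k n0 Dn); exists i.
have fneq0 (k : int) : (f k != 0) = coprimez k D%:Z.
  case kD: (coprimez k D%:Z); last by rewrite f0 ?kD ?eqxx.
  have [i ni ik] := coprimez_liftP n D k n0 Dn kD.
  by rewrite (fE i) // dchar_neq0.
have fper (k : int) : f (k + D%:Z) = f k.
  have e (j : 'I_n) : coprimez j n%:Z && (D%:Z %| j%:Z - (k + D%:Z))%Z =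
      coprimez j n%:Z && (D%:Z %| j%:Z - k)%Z.
    by rewrite opprD addrA rpredBr // dvdzz.
  by rewrite /f (eq_pick e).
have fmul (j k : int) : f (j * k) = f j * f k.
  have [|nj] := boolP (coprimez j D%:Z); last first.
    by rewrite (f0 j) // mul0r f0 // coprimezMl (negPf nj).
  move=> /(coprimez_liftP n D j n0 Dn)[j' j'n jj].
  have [|nk] := boolP (coprimez k D%:Z); last first.
    by rewrite (f0 k) // mulr0 f0 // coprimezMl (negPf nk) andbF.
  move=> /(coprimez_liftP n D k n0 Dn)[k' k'n kk].
  rewrite (fE j' j) // (fE k' k) // -dchar_mul; apply: fE; first by rewrite coprimezMl j'n.
  have -> : j'%:Z * k'%:Z - j * k = (j'%:Z - j) * k'%:Z + j * (k'%:Z - k) by ring.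
  by apply: rpredD; [exact: dvdz_mulr | exact: dvdz_mull].
exists (DirichletChar fper fmul fneq0) => k kn /=.
by rewrite (fE k) // subrr dvdz0.
Qed.

(** Multiplication by a unit v + 1 congruent to 1 mod D permutes the progression
and scales the sum by chi (v + 1).  A nonzero sum would thus force chi to be
trivial on all such units, hence to descend to D. *)
Lemma sum_primitive_char_progression (R : realType) (n D : nat)
    (chi : dirichlet_char R n) :
  (0 < n)%N -> primitive_char chi -> (D %| n)%N ->
  \sum_(0 <= j < n | (D %| j)%N) chi j.+1%:Z = (D == n)%:R.
Proof.
move=> n0 prim Dn; have [-> | neq] := eqVneq.
  rewrite big_mkcond big_ltn //= dvdn0 dchar1 big_nat_cond big1 ?addr0 // => j.
  by rewrite andbT => /andP[j0 jn]; rewrite gtnNdvd.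
have Dlt : (D < n)%N by rewrite ltn_neqAle neq dvdn_leq.
apply/eqP/negPn/negP => S0.
have [|psi] := dchar_descent R n D chi n0 Dn; last exact: prim.
move=> v Dv vn; apply: (mulIf S0); rewrite mul1r !big_mkord mulr_sumr.
(* Multiplication by v + 1 on the residues j + 1, in terms of j. *)
pose h (j : 'I_n) := Ordinal (ltn_pmod (v.+1 * j + v) n0).
have h_le (i j : 'I_n) : h i = h j -> (j <= i)%N.
  move=> /(congr1 val)/= /eqP; rewrite eqn_modDr => ij; rewrite leqNgt; apply/negP => lt_ij.
  have : (n %| j - i)%N.
    rewrite -(Gauss_dvdr _ (m := n) (n := v.+1)) 1?coprime_sym // mulnBr.
    by rewrite -eqn_mod_dvd ?leq_mul2l ?(ltnW lt_ij) ?orbT // eq_sym.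
  by rewrite gtnNdvd ?subn_gt0 // (leq_ltn_trans (leq_subr _ _)).
have h_inj : injective h.
  by move=> i j ij; apply/val_inj/eqP; rewrite eqn_leq !h_le.
rewrite [RHS](reindex_inj h_inj) /=; apply: eq_big => j.
  have -> : (D %| (v.+1 * j + v) %% n)%N = (D %| v.+1 * j + v)%N.
    by rewrite /dvdn modn_dvdm.
  by rewrite dvdn_addl // mulSn dvdn_addl // dvdn_mulr.
move=> _; rewrite -dchar_mul; apply: dchar_eqmod.
have -> : v.+1%:Z * j.+1%:Z - ((v.+1 * j + v) %% n).+1%N%:Z =
    (v.+1 * j + v)%N%:Z - ((v.+1 * j + v) %% n)%N%:Z.
  by rewrite ![in LHS]intS PoszD PoszM intS; ring.
by rewrite -eqz_mod_dvd -modz_nat modz_mod.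
Qed.

(** * The double counting *)

Theorem theorem1p1 (R : realType) (s n : nat) (chi : dirichlet_char R n)
    (hs : (0 < s)%N) (hn : (0 < n)%N) (hpow : exists m : nat, n = (m ^ s)%N)
    (hchi : primitive_char chi) :
  \sum_(1 <= k < n.+1 | gen_gcdn s k n == 1%N)
     (gen_gcdn s (k - 1) n)%:R * chi k%:Z
  = (klee s n)%:R :> R[i].
Proof.
have [m nE] := hpow.
have m0 : (0 < m)%N by move: hn; rewrite nE expn_gt0 => /orP[] // /eqP s0; rewrite s0 in hs.
have gn a : (gen_gcdn s a n %| n)%N by rewrite nE gen_gcdn_dvdn.
have -> : \sum_(1 <= k < n.+1 | gen_gcdn s k n == 1%N)
     (gen_gcdn s (k - 1) n)%:R * chi k%:Z =
   \sum_(1 <= k < n.+1) (gen_gcdn s (k - 1) n)%:R * chi k%:Z.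
  rewrite [LHS]big_mkcond; apply: eq_bigr => k _; case: ifP => // /eqP g1.
  suff /eqP -> : chi k == 0 by rewrite mulr0.
  by apply/negPn; rewrite dchar_neq0; apply/negP => co; apply: g1; exact: gen_gcdn_coprime.
rewrite big_add1 /=.
(* Here j stands for k - 1. *)
have -> : \sum_(0 <= j < n) (gen_gcdn s (j.+1 - 1) n)%:R * chi j.+1%:Z =
    \sum_(1 <= x < n.+1) \sum_(0 <= j < n | (n %/ gen_gcdn s x n %| j)%N) chi j.+1%:Z.
  under [RHS]eq_bigr => x _ do rewrite big_mkcond.
  rewrite exchange_big /=; apply: eq_bigr => j _.
  rewrite subn1 /= {1}nE gen_gcdn_count // -nE natr_sum mulr_suml.
  by apply: eq_bigr => x _; case: ifP => _; rewrite ?mul1r ?mul0r.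
have div_dvd g : (g %| n)%N -> (n %/ g %| n)%N.
  by move=> gn'; rewrite -{2}(divnK gn') dvdn_mulr.
have div_eq g : (g %| n)%N -> (n %/ g == n)%N = (g == 1%N).
  by move=> gn'; rewrite eq_sym eqn_div ?(dvdn_gt0 hn) // -{2}[n]muln1 eqn_pmul2l.
under eq_bigr => x _ do
  rewrite sum_primitive_char_progression ?div_dvd // div_eq //.
rewrite -natr_sum /klee cardsE -sum1_card [in RHS]big_mkcond; congr _%:R.
rewrite -(big_mkord xpredT (fun x =>
  if (0 < x)%N && (gen_gcdn s x n == 1%N) then 1%N else 0%N)) [RHS]big_ltn //= add0n.
by apply: eq_big_nat => x /andP[-> _]; case: (_ == _).
Qed.
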